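(* Assume that for all integers $k \geq 1$ and $n > k$ the following holds: the supremum $b(k,n)$ (defined in the context) is attained at a continuous random vector $X$ in $\mathbb{R}^k$ if and only if the distribution of its projection $X^p = X/\|X\|_2$ on the unit sphere is symmetric with respect to $\underline{0}$, so that $b(k,n) = P\{\underline{0} \in \mathcal{H}(U_1, \ldots, U_n)\}$. Denote by $[x]$ the largest integer smaller than $x$. Then for any integers $k \geq 1$ and $n > k$: (a) $b(k, n+1) > b(k, n)$ and $b(k, n) > b(k+1, n)$; and (b) for any $\varepsilon \in (0, 0.5)$, $b([\varepsilon n], n) \to 1$ and $b([(1-\varepsilon) n], n) \to 0$ as $n \to \infty$.
   Context: $\underline{0}$ denotes the origin of $\mathbb{R}^k$, and $\mathcal{H}(x_1,\ldots,x_n)$ denotes the convex hull of the points $x_1,\ldots,x_n \in \mathbb{R}^k$. A continuous random vector in $\mathbb{R}^k$ is one whose distribution has a density with respect to Lebesgue measure on $\mathbb{R}^k$. For positive integers $k, n$, $$b(k,n) = \sup_{X} P[\underline{0} \in \mathcal{H}(X_1, X_2, \ldots, X_n)],$$ where the supremum is over all continuous random vectors $X$ in $\mathbb{R}^k$ and $X_1, \ldots, X_n$ are i.i.d. copies of $X$. The vectors $U_1, \ldots, U_n$ are i.i.d. copies of a random vector $U$ uniformly distributed on the unit sphere $\{x \in \mathbb{R}^k : \|x\|_2 = 1\}$ (for $k=1$, uniform on $\{-1,1\}$). The distribution of $X^p$ is symmetric with respect to $\underline{0}$ if $X^p$ and $-X^p$ have the same distribution. Under the assumption in the claim, a known formula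 of Wendel (1962) for $P\{\underline{0} \notin \mathcal{H}(U_1,\ldots,U_n)\}$ gives, for any $n > k$, $$b(k,n) = 1 - \left\{ \binom{n-1}{0} + \binom{n-1}{1} + \cdots + \binom{n-1}{k-1} \right\} 2^{-(n-1)}.$$ In (b), $n$ is taken large enough that $[\varepsilon n] \geq 1$. *)

(* Defs.v *)
From HB Require Import structures.
From mathcomp Require Import all_boot all_order all_algebra.
From mathcomp Require Import all_classical all_reals all_analysis.

Set Implicit Arguments.
Unset Strict Implicit.
Unset Printing Implicit Defensive.

Import Order.TTheory GRing.Theory Num.Theory.
Import numFieldNormedType.Exports.

Local Open Scope classical_set_scope.
Local Open Scope ring_scope.

Definition measure_rV_display : measure_display.
Proof. exact: default_measure_display. Qed.

Section measurable_rV.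
Context {R : realType} (k : nat).

Let coor (j : 'I_k) (v : 'rV[R]_k) : measurableTypeR R := v ord0 j.

Let rV_set0 : g_sigma_preimage coor set0.
Proof. exact: sigma_algebra0. Qed.

Let rV_setC A : g_sigma_preimage coor A -> g_sigma_preimage coor (~` A).
Proof. exact: sigma_algebraC. Qed.

Let rV_bigcup (F : (set 'rV[R]_k)^nat) :
  (forall i, g_sigma_preimage coor (F i)) ->
  g_sigma_preimage coor (\bigcup_i (F i)).
Proof. exact: sigma_algebra_bigcup. Qed.

(* The product sigma-algebra, which coincides with the Borel one. *)
HB.instance Definition _ :=
  @isMeasurable.Build measure_rV_display 'rV[R]_k (g_sigma_preimage coor)
    rV_set0 rV_setC rV_bigcup.

Lemma measurable_coor (j : 'I_k) :
  measurable_fun [set: 'rV[R]_k]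
    (fun v : 'rV[R]_k => v ord0 j : measurableTypeR R).
Proof.
move=> _ Y mY; rewrite setTI; apply: sub_sigma_algebra => /=.
rewrite -bigcup_seq/=; exists j => /=; first by rewrite mem_index_enum.
by exists Y => //; rewrite setTI.
Qed.

Lemma measurable_rVP d (T : measurableType d) (f : T -> 'rV[R]_k) :
  measurable_fun setT f <->
  forall j, measurable_fun setT (fun x => f x ord0 j : measurableTypeR R).
Proof.
split=> [mf j|mf].
  exact: (measurableT_comp (measurable_coor j) mf).
apply: (@iffRL _ (g_sigma_preimage (fun j => coor j \o f) `<=` measurable)).
  rewrite g_sigma_preimage_comp; split=> [mf' A [/= C preC <-]|prefS].
    exact: mf'.
  by move=> _ A mA; apply: prefS; exists A.
apply: smallest_sub; first exact: sigma_algebra_measurable.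
move=> A; rewrite -bigcup_seq => -[j _] [B mB <-].
exact: mf.
Qed.

End measurable_rV.

Section rV_cons.
Context {R : realType} (k : nat).

Definition rV_cons (p : measurableTypeR R * 'rV[R]_k) : 'rV[R]_k.+1 :=
  \row_j (if unlift ord0 j is Some i then p.2 ord0 i else p.1).

Definition rV_uncons (v : 'rV[R]_k.+1) : measurableTypeR R * 'rV[R]_k :=
  (v ord0 ord0, \row_i v ord0 (lift ord0 i)).

Lemma rV_consK : cancel rV_cons rV_uncons.
Proof.
move=> [x v]; rewrite /rV_uncons mxE unlift_none; congr (_, _).
by apply/rowP => i; rewrite !mxE liftK.
Qed.

Lemma rV_unconsK : cancel rV_uncons rV_cons.
Proof.
move=> v; apply/rowP => j; rewrite mxE.
by case: unliftP => [i ->|->]; rewrite ?mxE.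
Qed.

Lemma measurable_rV_cons : measurable_fun setT rV_cons.
Proof.
apply/measurable_rVP => j.
under eq_fun do rewrite mxE.
case: unliftP => [i _|_]; last exact: measurable_fst.
exact: (measurableT_comp (measurable_coor i) measurable_snd).
Qed.

Lemma measurable_rV_uncons : measurable_fun setT rV_uncons.
Proof.
apply/measurable_fun_pairP; split; first exact: measurable_coor.
apply/measurable_rVP => j.
under eq_fun do rewrite mxE.
exact: measurable_coor.
Qed.

End rV_cons.

Section lebesgue_rV.
Context {R : realType}.

HB.instance Definition _ k := isMeasurableFun.Build _ _ _ _
  (@rV_cons R k) (@measurable_rV_cons R k).

Section step.
Context (k : nat) (mu : {sigma_finite_measure set 'rV[R]_k -> \bar R}).

Definition lebesgue_rV_step : set 'rV[R]_k.+1 -> \bar R :=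
  pushforward (@lebesgue_measure R \x mu)%E (@rV_cons R k).

Let lebesgue_rV_step0 : lebesgue_rV_step set0 = 0%E.
Proof. exact: measure0. Qed.

Let lebesgue_rV_step_ge0 A : (0 <= lebesgue_rV_step A)%E.
Proof. exact: measure_ge0. Qed.

Let lebesgue_rV_step_sigma_additive : semi_sigma_additive lebesgue_rV_step.
Proof. exact: measure_semi_sigma_additive. Qed.

HB.instance Definition _ := isMeasure.Build _ _ _ lebesgue_rV_step
  lebesgue_rV_step0 lebesgue_rV_step_ge0 lebesgue_rV_step_sigma_additive.

Let lebesgue_rV_step_sigma_finite : sigma_finite setT lebesgue_rV_step.
Proof.
have /sigma_finiteP[F [FT ndF Foo]] := sigma_finiteT (@lebesgue_measure R).
have /sigma_finiteP[G [GT ndG Goo]] := sigma_finiteT mu.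
exists (fun n => @rV_uncons R k @^-1` (F n `*` G n)).
  apply/esym; rewrite -subTset => v _.
  have : [set: measurableTypeR R] (rV_uncons v).1 by [].
  rewrite FT => -[n _ Fn].
  have : [set: 'rV[R]_k] (rV_uncons v).2 by [].
  rewrite GT => -[m _ Gm].
  exists (maxn n m) => //; split.
  - by move: Fn; exact/subsetPset/ndF/leq_maxl.
  - by move: Gm; exact/subsetPset/ndG/leq_maxr.
move=> n; have [mF Fn] := Foo n; have [mG Gn] := Goo n; split.
  rewrite -[X in measurable X]setTI.
  by apply: measurable_rV_uncons => //; exact: measurableX.
rewrite /lebesgue_rV_step /pushforward.
have -> : @rV_cons R k @^-1` (@rV_uncons R k @^-1` (F n `*` G n)) = F n `*` G n.
  rewrite -comp_preimage (_ : _ \o _ = id)//.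
  exact/funext/rV_consK.
by rewrite product_measure1E// lte_mul_pinfty// ge0_fin_numE.
Qed.

HB.instance Definition _ := Measure_isSigmaFinite.Build _ _ _
  lebesgue_rV_step lebesgue_rV_step_sigma_finite.

End step.

Fixpoint lebesgue_rV (k : nat) :
    {sigma_finite_measure set 'rV[R]_k -> \bar R} :=
  if k is k'.+1 then lebesgue_rV_step (lebesgue_rV k')
  else \d_(0 : 'rV[R]_0).

Lemma lebesgue_rV_box k (A : 'I_k -> set (measurableTypeR R)) :
  (forall j, measurable (A j)) ->
  lebesgue_rV k [set v | forall j, A j (v ord0 j)] =
  (\prod_(j < k) lebesgue_measure (A j))%E.
Proof.
elim: k A => [|k IHk] A mA.
  by rewrite big_ord0 /= diracE mem_set// => -[].
rewrite big_ord_recl -IHk//= /lebesgue_rV_step /pushforward /=.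
rewrite -product_measure1E//.
  congr (_ _); apply/seteqP; split => [[x v] /= Av|[x v] /= [Ax Av] j].
    split; first by have := Av ord0; rewrite mxE unlift_none.
    by move=> j; have := Av (lift ord0 j); rewrite mxE liftK.
  by rewrite mxE; case: unliftP => [i ->|->].
set B := (X in measurable X).
have -> : B = \bigcap_(j in [set: 'I_k])
  ((fun v : 'rV[R]_k => v ord0 j : measurableTypeR R) @^-1` A (lift ord0 j)).
  by apply/seteqP; split=> [v Av j _|v Av j]; [exact: Av|exact: (Av j)].
apply: fin_bigcap_measurable => // j _.
by rewrite -[X in measurable X]setTI; exact: measurable_coor.
Qed.

End lebesgue_rV.

Section random_vectors.
Context {R : realType}.

Definition l2norm k (x : 'rV[R]_k) : R := Num.sqrt (\sum_j x ord0 j ^+ 2).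

Definition sphere_proj k (x : 'rV[R]_k) : 'rV[R]_k := (l2norm x)^-1 *: x.

Definition conv_hull k n (x : 'I_n -> 'rV[R]_k) : set 'rV[R]_k :=
  [set y | exists a : 'I_n -> R,
    [/\ forall i, 0 <= a i, \sum_i a i = 1 & y = \sum_i a i *: x i]].

Definition continuous_rvec k d (T : measurableType d) (P : probability T R)
    (X : {RV P >-> 'rV[R]_k}) : Prop :=
  exists f : 'rV[R]_k -> measurableTypeR R,
    [/\ measurable_fun setT f, forall x, 0 <= f x :> R &
      forall A, measurable A ->
        distribution P X A = (\int[lebesgue_rV k]_(x in A) (f x)%:E)%E].

(* The product rule for subfamilies is obtained by taking [A i = setT] for the
   other indices. *)
Definition mutually_independent k n d (T : measurableType d)
    (P : probability T R) (X : 'I_n -> {RV P >-> 'rV[R]_k}) : Prop :=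
  forall A : 'I_n -> set 'rV[R]_k, (forall i, measurable (A i)) ->
    P (\bigcap_(i in [set: 'I_n]) (X i @^-1` A i)) =
    (\prod_(i < n) P (X i @^-1` A i))%E.

(* The copies may live on a probability space other than that of [X]. *)
Definition iid_copies k n d (T : measurableType d) (P : probability T R)
    (X : {RV P >-> 'rV[R]_k}) d' (T' : measurableType d')
    (P' : probability T' R) (Y : 'I_n -> {RV P' >-> 'rV[R]_k}) : Prop :=
  (forall i A, measurable A -> distribution P' (Y i) A = distribution P X A) /\
  mutually_independent Y.

Definition hull_prob k n d (T : measurableType d) (P : probability T R)
    (X : 'I_n -> {RV P >-> 'rV[R]_k}) : \bar R :=
  P [set w | conv_hull (fun i => X i w) 0].

Definition symmetric_proj k d (T : measurableType d) (P : probability T R)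
    (X : {RV P >-> 'rV[R]_k}) : Prop :=
  forall A, measurable A ->
    P [set w | A (sphere_proj (X w))] = P [set w | A (- sphere_proj (X w))].

(* The uniform law is the only rotation-invariant probability on the sphere; for
   [k = 1] the orthogonal matrices are [1] and [-1], so it is the uniform law on
   [{-1, 1}]. *)
Definition uniform_on_sphere k d (T : measurableType d) (P : probability T R)
    (U : {RV P >-> 'rV[R]_k}) : Prop :=
  P [set w | l2norm (U w) = 1] = 1%E /\
  forall Q : 'M[R]_k, Q *m Q^T = 1%:M ->
    forall A, measurable A -> P [set w | A (U w *m Q)] = P [set w | A (U w)].

Definition b (k n : nat) : \bar R :=
  ereal_sup [set p | exists d (T : measurableType d) (P : probability T R)
    (X : {RV P >-> 'rV[R]_k}) d' (T' : measurableType d')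
    (P' : probability T' R) (Y : 'I_n -> {RV P' >-> 'rV[R]_k}),
    [/\ continuous_rvec X, iid_copies X Y & p = hull_prob Y]].

(* The largest integer strictly smaller than [x], see [int_belowP]. *)
Definition int_below (x : R) : int := Num.ceil x - 1.

Lemma int_belowP (x : R) (m : int) : (m <= int_below x) = (m%:~R < x).
Proof. by rewrite /int_below lerBrDr -ltzD1 ltrD2r ceil_gt_int. Qed.

End random_vectors.

Arguments b R k n : clear implicits.

(* Main.v *)
From HB Require Import structures.
Require Import Defs.
From mathcomp Require Import all_boot all_order all_algebra.
From mathcomp Require Import all_classical all_reals all_analysis.
From mathcomp Require Import measurable_realfun ring lra.

Set Implicit Arguments.
Unset Strict Implicit.
Unset Printing Implicit Defensive.

Import Order.TTheory GRing.Theory Num.Theory.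
Import numFieldNormedType.Exports.

Local Open Scope classical_set_scope.
Local Open Scope ring_scope.

(** The theorem reduces to a form of Wendel's formula: for a symmetric law [mu]
    on [R^k] that gives no mass to hyperplanes through the origin, [n] i.i.d.
    points have the origin in their convex hull with probability [wendel n k],
    where [wendel n.+1 k.+1 = (wendel n k.+1 + wendel n k) / 2]; this is the
    probability that a binomial variable with parameters [n - 1] and [1/2] is at
    least [k].

    The recursion is proved directly on probabilities ([hull_wendel]), without
    counting sign patterns or discussing general position. Single out one of the
    points, [z <> 0], and let [x] be the others. The origin is in the hulls of
    both [z :: x] and [- z :: x] exactly when it is in the hull of [x]
    ([conv_hull0_cons_opp]), and it is in the hull of at least one of them
    exactly when it is in the hull of the projection of [x] along the line of [z]
    ([conv_hull0_quotient]). Hence the probabilities, given [z], of the events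
    for [z] and [- z] add up to the sum of a probability in dimension [k.+1] and
    one in dimension [k], both for [n] points; the projected points are again
    i.i.d. with a symmetric law that does not charge hyperplanes
    ([hull_section]). Integrating over [z] and using its symmetry gives the
    recursion. The same two equivalences, without symmetry, show that at most [k]
    points of a continuous law on [R^k] almost surely do not have the origin in
    their hull ([hull_null]); this covers [b(k+1, n)] for [n = k+1], to which
    the characterization of the maximizers does not apply.

    Some continuous symmetric law is needed to conclude that
    [b(k, n) = wendel n k] ([b_wendel]): the uniform law on a centred cube of
    volume one is used. The existence of i.i.d. copies on one probability space,
    and the fact that probabilities of hull events depend only on the common
    law, come from the iterated product measure [iter_prod].

    Monotonicity is then an induction on the recursion. For the limits, the
    recursion has the explicit solutions
    [((2k - n + D)^2 + n) / D^2], one for each [D]; comparing them with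
    [wendel] and taking [D = n - 2k] gives a Chebyshev bound
    [n / (n - 2k)^2] for [wendel n k] when [n <= 2k] and for [1 - wendel n k]
    when [2k <= n]. *)

(** * The event that the origin lies in a convex hull is measurable *)

Section Hull.
Context {R : realType}.

(** The normalization of the weights is irrelevant for the origin, and this
    homogeneous form is the one that can be scaled, added and projected. *)
Lemma conv_hull0P n k (x : 'I_n -> 'rV[R]_k) :
  conv_hull x 0 <-> exists a : 'I_n -> R,
    [/\ forall i, 0 <= a i, exists i, 0 < a i & \sum_i a i *: x i = 0].
Proof.
split=> [[a [a0 a1 ax]]|[a [a0 [i ai] ax]]].
  exists a; split=> //; apply: contrapT => nex.
  have : \sum_i a i = 0.
    apply: big1 => i _; apply/eqP; rewrite eq_le a0 andbT leNgt.
    by apply/negP => ai; apply: nex; exists i.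
  by rewrite a1 => /eqP; rewrite oner_eq0.
have S0 : 0 < \sum_i a i.
  by rewrite (bigD1 i)//= ltr_wpDr// sumr_ge0.
exists (fun i => a i / \sum_i a i); split=> [j||].
- by rewrite divr_ge0// ltW.
- by rewrite -mulr_suml divff// gt_eqF.
- rewrite (eq_bigr (fun i => (\sum_i a i)^-1 *: (a i *: x i))).
    by rewrite -scaler_sumr ax scaler0.
  by move=> j _; rewrite scalerA mulrC.
Qed.

Lemma cube_cluster n (u : nat -> 'I_n -> R) :
  (forall m i, 0 <= u m i <= 1) ->
  exists a : 'I_n -> R, forall (e : R) M, 0 < e ->
    exists2 m, (M <= m)%N & forall i, `|u m i - a i| < e.
Proof.
move=> u01.
have Kc := @rV_compact R n (fun=> `[0, 1]%classic) (fun=> @segment_compact R 0 1).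
have [|v [_ vcl]] := Kc ((fun m => \row_i u m i) @ \oo) _.
  by exists 0%N => // m _ i; rewrite mxE /= in_itv /=.
exists (fun i => v ord0 i) => e M e0.
have [|w [[m Mm <-] [_ B]]] :=
    vcl ((fun m => \row_i u m i) @` [set m | (M <= m)%N]) (ball v e) _
      (nbhsx_ballx v e e0).
  by exists M => // m Mm; exists m.
exists m => // i; have := B ord0 i.
by rewrite mxE /ball /= distrC.
Qed.

(** Measurability of the hull event is not clear from its definition, which
    quantifies over uncountably many weights. Rounding the weights down to
    multiples of [1 / N.+1] changes the combination by [O(1 / N.+1)] and leaves
    finitely many choices for each [N]; conversely, compactness of the cube gives
    a limit of the rounded weights. *)
Lemma conv_hull0_grid n k (x : 'I_n -> 'rV[R]_k) :
  conv_hull x 0 <-> forall N, exists c : {ffun 'I_n -> 'I_N.+2},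
    [/\ (N.+1 <= \sum_i c i + n)%N, (\sum_i c i <= N.+1)%N &
     forall j, `|\sum_i (c i)%:R * x i ord0 j| <= \sum_i `|x i ord0 j|].
Proof.
split=> [[a [a0 a1 ax]] N|grid].
  have a1i i : a i <= 1 by rewrite -a1 (bigD1 i)//= lerDl sumr_ge0.
  have eN : N.+1%:R = \sum_i N.+1%:R * a i by rewrite -mulr_sumr a1 mulr1.
  have ti i : (Num.truncn (N.+1%:R * a i))%:R <= N.+1%:R * a i
       < (Num.truncn (N.+1%:R * a i))%:R + 1.
    by rewrite natr1 truncn_itv// mulr_ge0.
  have tN i : (Num.truncn (N.+1%:R * a i) < N.+2)%N.
    rewrite ltnS -(ler_nat R); case/andP: (ti i) => /le_trans h _; apply: h.
    by rewrite ler_piMr.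
  exists [ffun i => Ordinal (tN i)]; split=> [||j].
  - rewrite -(ler_nat R) natrD natr_sum.
    rewrite [leLHS]eN.
    rewrite (_ : n%:R = \sum_(i < n) 1); last by rewrite sumr_const card_ord.
    rewrite -big_split/=; apply: ler_sum => i _; rewrite ffunE/=.
    by case/andP: (ti i) => _ /ltW.
  - rewrite -(ler_nat R) natr_sum [leRHS]eN.
    by apply: ler_sum => i _; rewrite ffunE/=; case/andP: (ti i).
  - have axj : \sum_i (N.+1%:R * a i) * x i ord0 j = 0.
      have /(congr1 (fun v : 'rV_k => v ord0 j)) := ax.
      rewrite mxE summxE => /esym axj.
      under eq_bigr do rewrite -mulrA.
      rewrite -mulr_sumr;
      rewrite (eq_bigr (fun i => (a i *: x i) ord0 j)) ?axj ?mulr0//.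
      by move=> i _; rewrite mxE.
    rewrite -[X in `|X|]subr0 -[X in _ - X]axj -sumrB.
    apply: le_trans (ler_norm_sum _ _ _) _; apply: ler_sum => i _.
    rewrite ffunE/= -mulrBl normrM ler_piMl// distrC ger0_norm ?subr_ge0.
      by case/andP: (ti i) => _ /ltW; rewrite -lerBlDl.
    by case/andP: (ti i).
pose c m := projT1 (cid (grid m)).
have cP m := projT2 (cid (grid m)); rewrite -/(c _) in cP.
pose u m (i : 'I_n) : R := (c m i)%:R / m.+1%:R.
have u01 m i : 0 <= u m i <= 1.
  rewrite divr_ge0//= ler_pdivrMr// mul1r ler_nat.
  by rewrite -ltnS ltn_ord.
have [a aP] := cube_cluster u01.
(* A linear form that is within O(1/m) of [b] along the sequence equals [b]
   at the cluster point. *)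
have lim0 (w : 'I_n -> R) (b C : R) :
    (forall m, `|\sum_i u m i * w i - b| <= C / m.+1%:R) ->
    \sum_i a i * w i = b.
  move=> h; apply/eqP; rewrite -subr_eq0 -normr_le0; apply/ler_addgt0Pr => e e0.
  rewrite add0r.
  set W := 1 + \sum_i `|w i|.
  have W0 : 0 < W by rewrite ltr_pwDl// sumr_ge0.
  have [M MP] : exists M, forall m, (M <= m)%N -> C / m.+1%:R <= e / 2.
    exists (Num.truncn (`|C| / (e / 2))) => m mM.
    rewrite ler_pdivrMr// mulrC -ler_pdivrMr ?divr_gt0//.
    apply: (@le_trans _ _ (`|C| / (e / 2))).
      by rewrite ler_pM2r ?invr_gt0 ?divr_gt0// ler_norm.
    have h0 : 0 <= `|C| / (e / 2) by rewrite divr_ge0// divr_ge0// ltW.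
    have /andP[_ /ltW /le_trans] := truncn_itv h0; apply.
    by rewrite ler_nat ltnS.
  have [|m Mm um] := aP (e / 2 / W) M; first by rewrite !divr_gt0.
  have -> : \sum_i a i * w i - b =
      (\sum_i u m i * w i - b) - \sum_i (u m i - a i) * w i.
    rewrite [X in _ = _ - X](eq_bigr (fun i => u m i * w i - a i * w i)).
      by rewrite sumrB; ring.
    by move=> i _; rewrite mulrBl.
  apply: le_trans (ler_normB _ _) _.
  rewrite [leRHS]splitr; apply: lerD.
    exact: le_trans (h m) (MP _ Mm).
  apply: le_trans (ler_norm_sum _ _ _) _.
  apply: (@le_trans _ _ (\sum_i (e / 2 / W) * `|w i|)).
    by apply: ler_sum => i _; rewrite normrM ler_wpM2r// ltW.
  rewrite -mulr_sumr -mulrA ler_piMr ?divr_ge0 ?ltW//.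
  by rewrite mulrC ltr_pdivrMr// mul1r /W ltrDr.
exists a; split=> [i||].
- rewrite leNgt; apply/negP => ai.
  have [|m _ /(_ i)] := aP (- a i) 0%N; first by rewrite oppr_gt0.
  rewrite ltNge => /negP; apply; have /andP[ui _] := u01 m i.
  by rewrite ger0_norm ?subr_ge0 ?(le_trans (ltW ai))// lerDr.
- rewrite (eq_bigr (fun i => a i * 1)); last by move=> i _; rewrite mulr1.
  apply: (lim0 _ _ n%:R) => m.
  under eq_bigr do rewrite mulr1; rewrite -mulr_suml -natr_sum.
  have [c1 c2 _] := cP m.
  rewrite distrC ger0_norm; last first.
    by rewrite subr_ge0 ler_pdivrMr// mul1r ler_nat.
  rewrite -[X in X - _](@divff _ m.+1%:R)// -mulrBl ler_pM2r ?invr_gt0//.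
  by rewrite lerBlDl -natrD ler_nat.
- apply/rowP => j; rewrite mxE summxE; apply/esym.
  rewrite (eq_bigr (fun i => a i * x i ord0 j)); last by move=> i _; rewrite mxE.
  apply: (lim0 _ _ (\sum_i `|x i ord0 j|)) => m; rewrite subr0.
  rewrite (eq_bigr (fun i => m.+1%:R^-1 * ((c m i)%:R * x i ord0 j))).
    rewrite -mulr_sumr normrM mulrC (ger0_norm (_ : 0 <= m.+1%:R^-1))//.
    by rewrite ler_pM2r ?invr_gt0//; have [_ _] := cP m; apply.
  by move=> i _; rewrite /u mulrCA mulrA.
Qed.

Lemma measurable_conv_hull0 n k d (T : measurableType d)
    (X : 'I_n -> T -> 'rV[R]_k) : (forall i, measurable_fun setT (X i)) ->
  measurable [set w | conv_hull (fun i => X i w) 0].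
Proof.
move=> mX.
have mXj i j : measurable_fun setT (fun w => X i w ord0 j : measurableTypeR R).
  exact: (measurable_rVP _).1 (mX i) j.
pose A N (c : {ffun 'I_n -> 'I_N.+2}) (j : 'I_k) :=
  [set w | `|\sum_i (c i)%:R * X i w ord0 j| <= \sum_i `|X i w ord0 j|].
pose ok N (c : {ffun 'I_n -> 'I_N.+2}) :=
  (N.+1 <= \sum_i c i + n)%N && (\sum_i c i <= N.+1)%N.
rewrite (_ : [set _ | _] =
  \bigcap_N \bigcup_(c in [set c | @ok N c]) \bigcap_(j in setT) A N c j).
  apply: bigcapT_measurable => N; apply: fin_bigcup_measurable.
    exact: finite_finset.
  move=> c _; apply: fin_bigcap_measurable; first exact: finite_finset.
  move=> j _; rewrite -[A _ _ _]setTI.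
  apply: measurable_fun_le => //.
    apply: measurableT_comp => //; apply: measurable_sum => i.
    by apply: measurable_funM => //; exact: mXj.
  apply: (@measurable_sum _ _ _ _ _ _ (fun i w => `|X i w ord0 j|)) => i.
  exact: (measurableT_comp (@normr_measurable R setT) (mXj i j)).
apply/seteqP; split=> [w /= /conv_hull0_grid g N _|w /= g].
  have [c [c1 c2 c3]] := g N; exists c; first by rewrite /ok /= c1.
  by move=> j _; exact: c3.
apply/conv_hull0_grid => N; have [c /= /andP[c1 c2] c3] := g N I.
by exists c; split=> // j; exact: (c3 j I).
Qed.

End Hull.

(** * Adding a point to a convex hull *)

Section Cone.
Context {R : realType}.

Lemma conv_hull0_consP n k (z : 'rV[R]_k) (x : n.-tuple 'rV[R]_k) :
  conv_hull (tnth (cons_tuple z x)) 0 <-> exists al, exists a : 'I_n -> R,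
    [/\ 0 <= al, forall i, 0 <= a i, 0 < al \/ exists i, 0 < a i
      & al *: z + \sum_i a i *: tnth x i = 0].
Proof.
rewrite conv_hull0P; split=> [[a [a0 [i ai] ax]]|[al [a [al0 a0 pos ax]]]].
  exists (a ord0), (fun i => a (lift ord0 i)); split=> //.
    by case: (unliftP ord0 i) ai => [j ->|->]; [right; exists j|left].
  rewrite -[RHS]ax big_ord_recl tnth0; congr (_ + _).
  by apply: eq_bigr => j _; rewrite tnthS.
exists (fun i => if unlift ord0 i is Some j then a j else al); split=> [i||].
- by case: unliftP.
- case: pos => [al1|[i ai]]; first by exists ord0; rewrite unlift_none.
  by exists (lift ord0 i); rewrite liftK.
- rewrite big_ord_recl unlift_none tnth0 -[RHS]ax; congr (_ + _).
  by apply: eq_bigr => j _; rewrite liftK tnthS.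
Qed.

(** A relation using [z] with weight [al] and one using [- z] with weight [be]
    combine, with factors [be] and [al], into a relation among [x] alone. *)
Lemma conv_hull0_cons_opp n k (z : 'rV[R]_k) (x : n.-tuple 'rV[R]_k) : z != 0 ->
  conv_hull (tnth x) 0 <->
  conv_hull (tnth (cons_tuple z x)) 0 /\ conv_hull (tnth (cons_tuple (- z) x)) 0.
Proof.
have sum_opp (u v : 'rV[R]_k) : u + v = 0 -> v = - u.
  by move=> uv; apply/eqP; rewrite -addr_eq0 addrC uv.
move=> z0; rewrite !conv_hull0_consP conv_hull0P; split.
  move=> [a [a0 ai ax]].
  by split; exists 0, a; split=> //; do ?[by right]; rewrite scale0r add0r.
move=> [[al [a [al0 a0 pa ax]]] [be [b [be0 b0 pb bx]]]].
have [al1|al1] := eqVneq al 0.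
  by move: pa ax; rewrite al1 ltxx scale0r add0r => -[//|ai] ax; exists a.
have [be1|be1] := eqVneq be 0.
  by move: pb bx; rewrite be1 ltxx scale0r add0r => -[//|bi] bx; exists b.
have alp : 0 < al by rewrite lt_def al1.
have bep : 0 < be by rewrite lt_def be1.
exists (fun i => be * a i + al * b i); split=> [i||].
- by rewrite addr_ge0// mulr_ge0.
- apply: contrapT => nex.
  have a0' i : a i = 0.
    apply/eqP; rewrite eq_le a0 andbT leNgt; apply/negP => ai; apply: nex.
    by exists i; rewrite ltr_pwDl// ?mulr_gt0// mulr_ge0.
  move: ax; rewrite big1 ?addr0 => [/eqP|i _]; last by rewrite a0' scale0r.
  by rewrite scaler_eq0 (negPf al1) (negPf z0).
- under eq_bigr do rewrite scalerDl -!scalerA.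
  rewrite big_split/= -!scaler_sumr.
  have -> := sum_opp _ _ ax; have -> := sum_opp _ _ bx.
  by rewrite !scalerN opprK !scalerA mulrC addNr.
Qed.

(** A nonnegative relation among the projected points lifts to an equation
    between a nonnegative combination of [x] and some [c *: z]; the sign of [c]
    decides whether [- z] or [z] completes it. *)
Lemma conv_hull0_quotient n k l (z : 'rV[R]_k) (M : 'M[R]_(k, l))
    (x : n.-tuple 'rV[R]_k) :
  z != 0 -> (forall v : 'rV_k, v *m M = 0 <-> exists c, v = c *: z) ->
  conv_hull (fun i => tnth x i *m M) 0 <->
  conv_hull (tnth (cons_tuple z x)) 0 \/ conv_hull (tnth (cons_tuple (- z) x)) 0.
Proof.
have sum_opp (u v : 'rV[R]_k) : u + v = 0 -> v = - u.
  by move=> uv; apply/eqP; rewrite -addr_eq0 addrC uv.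
move=> z0 kM; rewrite !conv_hull0_consP conv_hull0P.
have sumM (a : 'I_n -> R) :
    \sum_i a i *: (tnth x i *m M) = (\sum_i a i *: tnth x i) *m M.
  by rewrite mulmx_suml; apply: eq_bigr => i _; rewrite scalemxAl.
have zM : z *m M = 0 by apply/kM; exists 1; rewrite scale1r.
have aux (w : 'rV_k) : w != 0 -> w *m M = 0 ->
   (exists al, exists a : 'I_n -> R, [/\ 0 <= al, forall i, 0 <= a i,
       0 < al \/ exists i, 0 < a i & al *: w + \sum_i a i *: tnth x i = 0]) ->
   exists a : 'I_n -> R, [/\ forall i, 0 <= a i, exists i, 0 < a i &
       \sum_i a i *: (tnth x i *m M) = 0].
  move=> w0 wM [al [a [al0 a0 pos ax]]]; exists a; split=> //.
    case: pos => // alp; apply: contrapT => nex.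
    move: ax; rewrite big1 ?addr0 => [/eqP|i _].
      by rewrite scaler_eq0 gt_eqF// (negPf w0).
    suff -> : a i = 0 by rewrite scale0r.
    apply/eqP; rewrite eq_le a0 andbT leNgt; apply/negP => ai; apply: nex.
    by exists i.
  by rewrite sumM (sum_opp _ _ ax) mulNmx -scalemxAl wM scaler0 oppr0.
split=> [[a [a0 ai]]|[|]].
- rewrite sumM => /kM[c cz]; have [c0|c0] := leP 0 c.
    right; exists c, a; split=> //; first by right.
    by rewrite cz scalerN addNr.
  left; exists (- c), a; split=> //; first by rewrite oppr_ge0 ltW.
    by right.
  by rewrite cz scaleNr addNr.
- exact: aux.
- by apply: aux; rewrite ?oppr_eq0// mulNmx zM oppr0.
Qed.

(** The second condition is the surjectivity of the quotient map in dual form: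
    it makes the preimage of a hyperplane a hyperplane. *)
Lemma quotient_by_line k (z : 'rV[R]_k.+1) : z != 0 ->
  exists M : 'M[R]_(k.+1, k),
    (forall v : 'rV_k.+1, v *m M = 0 <-> exists c, v = c *: z) /\
    (forall c : 'cV_k, M *m c = 0 -> c = 0).
Proof.
move=> z0.
have rk : \rank (cokermx z) = k by rewrite mxrank_coker rank_rV z0 subn1.
pose P r := exists M : 'M[R]_(k.+1, r),
  (forall v : 'rV_k.+1, v *m M = 0 <-> exists c, v = c *: z) /\
  (forall c : 'cV_r, M *m c = 0 -> c = 0).
suff : P (\rank (cokermx z)) by rewrite rk.
exists (col_base (cokermx z)); split=> [v|c].
  split=> [vM|[c ->]].
    have : (v <= z)%MS.
      by rewrite submxE -(mulmx_base (cokermx z)) mulmxA vM mul0mx.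
    by move/sub_rVP.
  have : (c *: z) *m cokermx z = 0 by apply/eqP; rewrite -submxE scalemx_sub.
  rewrite -{1}(mulmx_base (cokermx z)) mulmxA => /eqP.
  by rewrite mulmx_free_eq0 ?row_base_free// => /eqP.
move=> /(congr1 trmx); rewrite trmx_mul trmx0 => /eqP.
rewrite mulmx_free_eq0; first by rewrite trmx_eq0 => /eqP.
by rewrite /row_free mxrank_tr; exact: col_base_full.
Qed.

End Cone.

(** * Iterated products of a probability measure *)

Section IterProd.
Context d (T : measurableType d) {R : realType} (mu : probability T R).

Definition tuple_cons n (p : T * n.-tuple T) : n.+1.-tuple T :=
  cons_tuple p.1 p.2.

Lemma measurable_tuple_cons n : measurable_fun setT (@tuple_cons n).
Proof. exact: (measurable_cons measurable_fst measurable_snd). Qed.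

HB.instance Definition _ n := isMeasurableFun.Build _ _ _ _
  (@tuple_cons n) (@measurable_tuple_cons n).

Section Step.
Context n (nu : probability (n.-tuple T) R).

Definition iter_step : set (n.+1.-tuple T) -> \bar R :=
  pushforward (mu \x nu)%E (@tuple_cons n).

Let iter_step0 : iter_step set0 = 0%E.
Proof. exact: measure0. Qed.

Let iter_step_ge0 A : (0 <= iter_step A)%E.
Proof. exact: measure_ge0. Qed.

Let iter_step_sigma_additive : semi_sigma_additive iter_step.
Proof. exact: measure_semi_sigma_additive. Qed.

HB.instance Definition _ := isMeasure.Build _ _ _ iter_step
  iter_step0 iter_step_ge0 iter_step_sigma_additive.

Let iter_stepT : iter_step setT = 1%E.
Proof.
rewrite /iter_step /pushforward preimage_setT -setXTT.
rewrite product_measure1E//.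
by rewrite [X in (X * _)%E](probability_setT mu)
  [X in (_ * X)%E](probability_setT nu) mule1.
Qed.

HB.instance Definition _ :=
  Measure_isProbability.Build _ _ _ iter_step iter_stepT.

End Step.

Fixpoint iter_prod n : probability (n.-tuple T) R :=
  if n is n'.+1 then iter_step (iter_prod n') else \d_([tuple]).

Lemma iter_prodS n (A : set (n.+1.-tuple T)) :
  iter_prod n.+1 A =
  (\int[mu]_z iter_prod n [set x | A (cons_tuple z x)])%E.
Proof.
rewrite /= /iter_step /pushforward /product_measure1.
apply: eq_integral => z _ /=; congr (iter_prod n _).
by apply/seteqP; split=> x; rewrite /xsection /= inE.
Qed.

Lemma measurable_cons_section n (A : set (n.+1.-tuple T)) z : measurable A ->
  measurable [set x : n.-tuple T | A (cons_tuple z x)].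
Proof.
move=> mA; rewrite -[X in measurable X]setTI.
exact: (measurable_cons (measurable_cst z) (@measurable_id _ _ setT)).
Qed.

Lemma measurable_iter_section n (A : set (n.+1.-tuple T)) : measurable A ->
  measurable_fun setT (fun z => iter_prod n [set x | A (cons_tuple z x)]).
Proof.
move=> mA.
have mB : measurable (@tuple_cons n @^-1` A).
  by rewrite -[X in measurable X]setTI; exact: measurable_tuple_cons.
have := measurable_fun_xsection (iter_prod n) mB.
congr measurable_fun; apply/funext => z /=; congr (iter_prod n _).
by apply/seteqP; split=> x; rewrite /xsection /= inE.
Qed.

Definition box n (A : 'I_n -> set T) : set (n.-tuple T) :=
  [set x | forall i, A i (tnth x i)].

Lemma measurable_box n (A : 'I_n -> set T) : (forall i, measurable (A i)) ->
  measurable (box A).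
Proof.
move=> mA.
rewrite (_ : box A = \bigcap_(i in [set: 'I_n]) ((@tnth _ T ^~ i) @^-1` A i)).
  apply: fin_bigcap_measurable => // i _.
  by rewrite -[X in measurable X]setTI; exact: measurable_tnth.
by apply/seteqP; split=> [x Ax i _|x Ax i]; [exact: Ax|exact: Ax].
Qed.

Lemma iter_prod_box n (A : 'I_n -> set T) : (forall i, measurable (A i)) ->
  iter_prod n (box A) = (\prod_(i < n) mu (A i))%E.
Proof.
elim: n A => [|n IHn] A mA.
  by rewrite big_ord0 /= diracE mem_set// => -[].
rewrite big_ord_recl -IHn//= /iter_step /pushforward -product_measure1E//.
  congr (_ _); apply/seteqP; split=> [[z x] /= Ax|[z x] /= [Az Ax] i].
    by split=> [|i]; [exact: (Ax ord0)|have := Ax (lift ord0 i); rewrite tnthS].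
  by case: (unliftP ord0 i) => [j ->|->]; rewrite ?tnthS//; exact: Ax.
exact: measurable_box.
Qed.

(** Boxes are stable under intersection and contain the cylinders that generate
    the sigma-algebra of the tuples. *)
Lemma iter_prod_unique n (m : {measure set (n.-tuple T) -> \bar R}) :
  (forall A : 'I_n -> set T, (forall i, measurable (A i)) ->
    m (box A) = \prod_(i < n) mu (A i))%E ->
  forall E, measurable E -> m E = iter_prod n E.
Proof.
move=> mE E mEE; apply/esym.
pose G := [set B | exists2 A : 'I_n -> set T,
  (forall i, measurable (A i)) & B = box A].
have GT : G setT.
  by exists (fun=> setT) => //; apply/seteqP; split.
apply: (@measure_unique _ _ _ G (fun=> setT)) => //.
- apply/seteqP; split; last first.
    apply: smallest_sub; first exact: sigma_algebra_measurable.
    by move=> _ [A mA ->]; exact: measurable_box.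
  apply: smallest_sub; first exact: smallest_sigma_algebra.
  move=> B; rewrite -bigcup_seq => -[i _] [C mC <-].
  apply: sub_sigma_algebra; exists (fun j => if j == i then C else setT).
    by move=> j; case: ifP.
  rewrite setTI; apply/seteqP; split=> x /= Cx; last first.
    by have := Cx i; rewrite eqxx.
  by move=> j; case: eqP => // ->.
- move=> _ _ [A mA ->] [B mB ->]; exists (fun i => A i `&` B i).
    by move=> i; exact: measurableI.
  apply/seteqP; split=> [x [Ax Bx] i|x ABx].
    by split; [exact: Ax|exact: Bx].
  by split=> i; have [] := ABx i.
- by rewrite bigcup_const//; exists 0%N.
- by move=> _ [A mA ->]; apply: (etrans (iter_prod_box mA)); rewrite mE.
- by move=> k; rewrite [ltLHS](probability_setT (iter_prod n)) ltry.
Qed.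

End IterProd.

Section IidLaw.
Context d (T : measurableType d) {R : realType}.

(** Probabilities of events about an i.i.d. family depend only on the common
    law; this allows both an arbitrary sample space for the copies and the
    change of law in [iter_prod_distribution]. *)
Lemma iid_law (mu : probability T R) n d' (T' : measurableType d')
    (P : probability T' R) (Y : 'I_n -> T' -> T) :
  (forall i, measurable_fun setT (Y i)) ->
  (forall A : 'I_n -> set T, (forall i, measurable (A i)) ->
    P [set w | forall i, A i (Y i w)] = \prod_(i < n) mu (A i))%E ->
  forall E, measurable E ->
    P [set w | E [tuple Y i w | i < n]] = iter_prod mu n E.
Proof.
move=> mY PY E mE.
have mW : measurable_fun setT (fun w => [tuple Y i w | i < n]).
  apply/measurable_fun_tnthP => i; rewrite (_ : _ \o _ = Y i)//.
  by apply/funext => w /=; rewrite tnth_mktuple.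
pose W := mfun_Sub (mem_set mW : _ \in mfun).
rewrite -(@iter_prod_unique _ _ _ mu n (distribution P W))// => A mA.
rewrite -PY//; congr (P _); apply/seteqP; split=> w /= Aw i.
  by have := Aw i; rewrite /= tnth_mktuple.
by rewrite /= tnth_mktuple.
Qed.

End IidLaw.

Lemma iter_prod_distribution d (T : measurableType d) {R : realType}
    d' (T' : measurableType d') (mu : probability T R)
    (f : {RV mu >-> T'}) n E : measurable E ->
  iter_prod (distribution mu f) n E =
  iter_prod mu n [set x | E [tuple f (tnth x i) | i < n]].
Proof.
move=> mE; apply/esym.
apply: (@iid_law _ _ R (distribution mu f) n _ _ (iter_prod mu n)
  (fun i x => f (tnth x i))) => //.
- by move=> i; exact: (measurableT_comp (measurable_funPT f) (measurable_tnth i)).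
- move=> A mA; apply: (@iter_prod_box _ _ _ mu n (fun i => f @^-1` A i)) => i.
  exact: (measurable_funPTI f).
Qed.

(** * Wendel's recursion *)

Section Wendel.
Context {R : realType}.

Definition hull_tuples k n : set (n.-tuple 'rV[R]_k) :=
  [set x | conv_hull (tnth x) 0].

Arguments hull_tuples : clear implicits.

Lemma measurable_hull_tuples k n : measurable (hull_tuples k n).
Proof. by apply: measurable_conv_hull0 => i; exact: measurable_tnth. Qed.

Definition null_hyperplanes k (mu : set 'rV[R]_k -> \bar R) :=
  forall c : 'cV_k, c != 0 -> mu [set v | v *m c = 0] = 0%E.

Definition symmetric_measure k (mu : set 'rV[R]_k -> \bar R) :=
  forall A : set 'rV[R]_k, measurable A -> mu [set v | A (- v)] = mu A.

Lemma measurable_mulmxr k l (M : 'M[R]_(k, l)) :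
  measurable_fun setT (fun v : 'rV[R]_k => v *m M).
Proof.
apply/measurable_rVP => j; under eq_fun do rewrite mxE.
apply: (@measurable_sum _ _ _ _ _ _ (fun i (v : 'rV[R]_k) => v ord0 i * M i j)) => i.
by apply: measurable_funM => //; exact: measurable_coor.
Qed.

HB.instance Definition _ k l (M : 'M[R]_(k, l)) := isMeasurableFun.Build _ _ _ _
  (mulmxr M : 'rV[R]_k -> 'rV[R]_l) (measurable_mulmxr M).

Lemma measurable_oppv k : measurable_fun setT (fun v : 'rV[R]_k => - v).
Proof.
apply/measurable_rVP => j; under eq_fun do rewrite mxE.
by apply: measurable_funN; exact: measurable_coor.
Qed.

Lemma measurable_rV_set1 k (a : 'rV[R]_k) : measurable [set a].
Proof.
rewrite (_ : [set _] = \bigcap_(j in [set: 'I_k])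
    ((fun v : 'rV[R]_k => v ord0 j : measurableTypeR R) @^-1` [set a ord0 j])).
  apply: fin_bigcap_measurable => // j _.
  by rewrite -[X in measurable X]setTI; apply: measurable_coor.
apply/seteqP; split=> [_ -> j _//|v va] /=.
by apply/rowP => j; exact: va.
Qed.

Lemma measurable_affine_hyperplane k (c : 'cV[R]_k) (a : 'M[R]_1) :
  measurable [set v : 'rV[R]_k | v *m c = a].
Proof.
rewrite -[X in measurable X]setTI.
exact: (@measurable_mulmxr k 1%N c measurableT [set a] (@measurable_rV_set1 1%N a)).
Qed.

Lemma null_hyperplanes_set0 k (mu : {measure set 'rV[R]_k.+1 -> \bar R}) :
  null_hyperplanes mu -> mu [set 0] = 0%E.
Proof.
move=> h; apply/eqP; rewrite -measure_le0 -(h (const_mx 1)).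
  apply: le_measure; rewrite ?inE.
  - exact: measurable_rV_set1.
  - exact: measurable_affine_hyperplane.
  - by move=> _ -> /=; rewrite mul0mx.
by apply/eqP => /matrixP /(_ ord0 ord0) /eqP; rewrite !mxE oner_eq0.
Qed.

(** Inclusion-exclusion for the events of [z] and [- z]; [mu'] is the law of the
    projection of a point along the line of [z]. *)
Lemma hull_section k n (mu : probability 'rV[R]_k.+1 R) (z : 'rV[R]_k.+1) :
  null_hyperplanes mu -> z != 0 ->
  exists mu' : probability 'rV[R]_k R,
    [/\ null_hyperplanes mu', symmetric_measure mu -> symmetric_measure mu' &
    (iter_prod mu n [set x | hull_tuples _ _ (cons_tuple z x)] +
     iter_prod mu n [set x | hull_tuples _ _ (cons_tuple (- z)%R x)] =
     iter_prod mu n (hull_tuples _ n) + iter_prod mu' n (hull_tuples _ n))%E].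
Proof.
move=> nmu z0; have [M [kM iM]] := quotient_by_line z0.
pose f : {RV mu >-> 'rV[R]_k} := mulmxr M.
have eD := @iter_prod_distribution _ _ R _ _ mu f n _
  (@measurable_hull_tuples k n).
exists (distribution mu f); split.
- move=> c c0; rewrite /distribution /pushforward /=.
  rewrite -(nmu (M *m c)).
    by congr (mu _); apply/seteqP; split=> v /=; rewrite mulmxA.
  by apply: contra c0 => /eqP /iM ->.
- move=> smu A mA; rewrite /distribution /pushforward /=.
  apply: etrans (smu ((fun v => v *m M) @^-1` A) _).
    by congr (mu _); apply/seteqP; split=> v /=; rewrite mulNmx.
  by rewrite -[X in measurable X]setTI; exact: (measurable_mulmxr M).
rewrite eD.
set A := [set x | hull_tuples _ _ (cons_tuple z x)].
set B := [set x | hull_tuples _ _ (cons_tuple (- z) x)].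
have mA : measurable A.
  by apply: measurable_cons_section; exact: measurable_hull_tuples.
have mB : measurable B.
  by apply: measurable_cons_section; exact: measurable_hull_tuples.
rewrite [X in (_ = iter_prod mu n X + _)%E](_ : _ = A `&` B); last first.
  by apply/seteqP; split=> x /(conv_hull0_cons_opp _ z0).
rewrite [X in (_ = _ + iter_prod mu n X)%E](_ : _ = A `|` B); last first.
  apply/seteqP; split=> x /=.
    rewrite /hull_tuples/= (_ : tnth _ = fun i => tnth x i *m M).
      by move=> /(conv_hull0_quotient _ z0 kM).
    by apply/funext => i; rewrite tnth_mktuple.
  move=> /(conv_hull0_quotient _ z0 kM).
  rewrite /hull_tuples/= (_ : tnth [tuple _ | _ < _] = fun i => tnth x i *m M)//.
  by apply/funext => i; rewrite tnth_mktuple.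
have fA : (iter_prod mu n A < +oo)%E.
  by rewrite (le_lt_trans (probability_le1 _ mA))// ltry.
rewrite measureUfinl// [RHS]addeC subeK//.
by rewrite fin_num_measure//; exact: measurableI.
Qed.

(** This is [1 - (sum_(i < k) 'C(n - 1, i)) / 2 ^ (n - 1)] for [0 < n]. The
    value [0] for [n = 0] is that of an empty hull, and it takes precedence over
    the value [1] for [k = 0], where every point is the origin. *)
Fixpoint wendel n k : R :=
  match n, k with
  | 0%N, _ => 0
  | n'.+1, 0%N => 1
  | n'.+1, k'.+1 => (wendel n' k + wendel n' k') / 2
  end.

Lemma hull_tuples0 k : hull_tuples k 0 = set0.
Proof. by apply/seteqP; split=> // x /conv_hull0P[a [_ [[]]]]. Qed.

(** By [hull_section], the event for [z] is contained in the union of two events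
    that the induction makes negligible. *)
Lemma hull_null n k (mu : probability 'rV[R]_k R) : (n <= k)%N ->
  null_hyperplanes mu -> iter_prod mu n (hull_tuples _ n) = 0%E.
Proof.
elim: n k mu => [|n IHn] k mu nk nmu; first by rewrite hull_tuples0 measure0.
case: k => [//|k] in mu nk nmu *.
have mH := @measurable_hull_tuples k.+1 n.+1.
rewrite iter_prodS -(integral0 mu setT).
apply: ge0_ae_eq_integral => //; first exact: measurable_iter_section.
exists [set 0]; split; first exact: measurable_rV_set1.
  exact: null_hyperplanes_set0.
move=> z /= /not_implyP[_ h]; apply/eqP; apply: contrapT => /negP z0; apply: h.
have [mu' [nmu' _]] := hull_section n nmu z0.
rewrite (IHn _ _ _ nmu) ?(ltnW nk)// (IHn _ _ _ nmu')// adde0 => /eqP.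
by rewrite padde_eq0// => /andP[/eqP].
Qed.

(** Symmetry of [mu] makes the integral over [z] of the event for [z :: x] equal
    to that for [- z :: x], so twice it is the integral of the sum computed in
    [hull_section], which does not depend on [z]. *)
Lemma hull_wendel n k (mu : probability 'rV[R]_k R) :
  null_hyperplanes mu -> symmetric_measure mu ->
  iter_prod mu n (hull_tuples _ n) = (wendel n k)%:E.
Proof.
elim: n k mu => [|n IHn] k mu nmu smu; first by rewrite hull_tuples0 measure0.
case: k => [|k] in mu nmu smu *.
  rewrite (_ : hull_tuples _ _ = setT) ?probability_setT//.
  apply/seteqP; split=> // x _; apply/conv_hull0P; exists (fun=> 1); split=> //.
    by exists ord0.
  by apply/rowP => -[].
have mH := @measurable_hull_tuples k.+1 n.+1.
rewrite iter_prodS; set f := (X in integral _ _ X).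
have mf : measurable_fun setT f by exact: measurable_iter_section.
have f0 z : (0 <= f z)%E by [].
pose opp : {mfun 'rV[R]_k.+1 >-> 'rV[R]_k.+1} :=
  mfun_Sub (mem_set (@measurable_oppv k.+1) : _ \in mfun).
have fopp : (\int[mu]_z f z = \int[mu]_z f (- z)%R)%E.
  rewrite -(@ge0_integral_pushforward _ _ _ _ _ opp _ mu setT f)//.
  by apply: eq_measure_integral => A mA _; exact/esym/smu.
have mfo : measurable_fun setT (fun z : 'rV[R]_k.+1 => f (- z)).
  exact: (measurableT_comp mf (@measurable_oppv k.+1)).
have : (\int[mu]_z f z + \int[mu]_z f z = (wendel n k.+1 + wendel n k)%:E)%E.
  rewrite {2}fopp -ge0_integralD//.
  transitivity (\int[mu]_z (wendel n k.+1 + wendel n k)%:E)%E; last first.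
    by rewrite integral_cst// [X in (_ * X)%E](probability_setT mu) mule1.
  have wg (m l : nat) : 0 <= wendel m l.
    by elim: m l => [//|m IHm] [//|l] /=; rewrite divr_ge0// addr_ge0.
  apply: ge0_ae_eq_integral => //.
  - exact: emeasurable_funD.
  - by move=> z _; rewrite adde_ge0.
  - by move=> z _; rewrite lee_fin addr_ge0.
  exists [set 0]; split; first exact: measurable_rV_set1.
    exact: null_hyperplanes_set0.
  move=> z /= /not_implyP[_ h]; apply/eqP; apply: contrapT => /negP z0; apply: h.
  have [mu' [nmu' smu' ->]] := hull_section n nmu z0.
  by rewrite (IHn _ _ nmu smu) (IHn _ _ nmu' (smu' smu)).
have : (\int[mu]_z f z)%E \is a fin_num.
  by rewrite -iter_prodS fin_num_measure.
case: (\int[mu]_z f z)%E => // r _ [rr] /=; congr (_%:E).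
by rewrite -rr; field.
Qed.

End Wendel.

Arguments hull_tuples : clear implicits.
Arguments wendel {R}.

(** * Continuous laws and the uniform law on a cube *)

Section Lebesgue.
Context {R : realType}.

Lemma lebesgue_rVS k (A : set 'rV[R]_k.+1) :
  lebesgue_rV k.+1 A =
  (\int[@lebesgue_measure R]_x lebesgue_rV k [set v | A (rV_cons (x, v))])%E.
Proof.
rewrite /= /lebesgue_rV_step /pushforward /product_measure1.
apply: eq_integral => x _ /=; congr (lebesgue_rV k _).
by apply/seteqP; split=> v; rewrite /xsection /= inE.
Qed.

(** The affine form is what the induction on the dimension needs: fixing the
    first coordinate [x] turns the equation into one with right-hand side
    [a - x * c_0]. If all the other coefficients vanish, only [x = a / c_0] gives
    a nonempty section. *)
Lemma lebesgue_rV_hyperplane k (c : 'cV[R]_k) (a : R) : c != 0 ->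
  lebesgue_rV k [set v | v *m c = a%:M] = 0%E.
Proof.
elim: k c a => [|k IHk] c a c0.
  by case/eqP: c0; apply/matrixP => -[].
have consE x (v : 'rV_k) : rV_cons (x, v) *m c =
    (x * c ord0 ord0)%:M + v *m \col_i c (lift ord0 i) ord0.
  apply/matrixP => i j; rewrite !ord1 !mxE big_ord_recl mxE unlift_none eqxx mulr1n.
  by congr (_ + _); apply: eq_bigr => l _; rewrite !mxE liftK.
have [c'0|c'0] := eqVneq (\col_i c (lift ord0 i) ord0) 0; last first.
  rewrite lebesgue_rVS; under eq_integral.
    move=> x _.
    rewrite (_ : [set v | _] = [set v |
        v *m (\col_i c (lift ord0 i) ord0) = (a - x * c ord0 ord0)%:M]).
      by rewrite IHk//; over.
    apply/seteqP; split=> v /=; rewrite consE raddfB/=.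
      by move=> <-; rewrite addrC addKr.
    by move=> ->; rewrite addrC subrK.
  by rewrite integral0.
have c00 : c ord0 ord0 != 0.
  apply: contra c0 => /eqP c00; apply/eqP/matrixP => i j; rewrite ord1 mxE.
  case: (unliftP ord0 i) => [l ->|->//].
  by move/matrixP/(_ l ord0): c'0; rewrite !mxE.
have mS : measurable [set v : 'rV[R]_k.+1 | v *m c = a%:M].
  exact: measurable_affine_hyperplane.
have mC : measurable_fun setT (fun x : measurableTypeR R =>
    lebesgue_rV k [set v | rV_cons (x, v) *m c = a%:M]).
  have mB : measurable (@rV_cons R k @^-1` [set v | v *m c = a%:M]).
    by rewrite -[X in measurable X]setTI; exact: measurable_rV_cons.
  have := measurable_fun_xsection (lebesgue_rV k) mB.
  congr measurable_fun; apply/funext => z /=; congr (lebesgue_rV k _).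
  by apply/seteqP; split=> x; rewrite /xsection /= inE.
rewrite lebesgue_rVS -(integral0 (@lebesgue_measure R) setT).
apply: ge0_ae_eq_integral => //.
exists [set a / c ord0 ord0]; split; first exact: measurable_set1.
  exact: lebesgue_measure_set1.
move=> x /= /not_implyP[_ h]; apply/eqP; apply: contrapT => /negP xa; apply: h.
rewrite (_ : [set v | _] = set0) ?measure0//; apply/seteqP; split=> // v /=.
rewrite consE c'0 mulmx0 addr0 => /matrixP/(_ ord0 ord0).
rewrite !mxE eqxx !mulr1n => xc.
by move/eqP: xa; apply; rewrite -xc mulfK.
Qed.

Lemma symmetric_lebesgue_rV k : symmetric_measure (@lebesgue_rV R k).
Proof.
elim: k => [|k IHk] A mA.
  by congr (lebesgue_rV 0 _); apply/seteqP; split=> v /=;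
    rewrite (_ : - v = v)//; apply/rowP => -[].
pose neg (p : measurableTypeR R * 'rV[R]_k) : measurableTypeR R * 'rV[R]_k :=
  (- p.1, - p.2).
have mneg : measurable_fun setT neg.
  apply/measurable_fun_pairP; split.
    exact: (measurableT_comp (@oppr_measurable R setT) measurable_fst).
  exact: (measurableT_comp (@measurable_oppv R k) measurable_snd).
pose f : {mfun _ >-> _} := mfun_Sub (mem_set mneg : _ \in mfun).
have mB : measurable (@rV_cons R k @^-1` A).
  by rewrite -[X in measurable X]setTI; exact: measurable_rV_cons.
rewrite /= /lebesgue_rV_step /pushforward.
rewrite [RHS](@product_measure_unique _ _ _ _ _ lebesgue_measure (lebesgue_rV k)
  (pushforward (lebesgue_measure \x lebesgue_rV k)%E f))//.
  rewrite /pushforward; congr product_measure1; apply/seteqP; split=> p /=.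
    by congr A; apply/rowP => j; rewrite !mxE; case: unliftP => *; rewrite ?mxE.
  by congr A; apply/rowP => j; rewrite !mxE; case: unliftP => *; rewrite ?mxE.
move=> U V mU mV; rewrite /= /pushforward.
have eU : lebesgue_measure
    ((-%R : measurableTypeR R -> measurableTypeR R) @^-1` U) =
  lebesgue_measure U := lebesgue_measureN mU.
rewrite -eU -(IHk _ mV) -product_measure1E//.
- by rewrite -[X in measurable X]setTI; exact: oppr_measurable.
- by rewrite -[X in measurable X]setTI; exact: measurable_oppv.
Qed.

Lemma continuous_null_hyperplanes k d (T : measurableType d) (P : probability T R)
    (X : {RV P >-> 'rV[R]_k}) :
  continuous_rvec X -> null_hyperplanes (distribution P X).
Proof.
move=> [f [mf f0 fX]] c c0.
have mH := measurable_affine_hyperplane c 0.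
rewrite fX//; apply: null_set_integral => //.
  by apply/measurable_EFinP; exact: measurable_funTS.
have := lebesgue_rV_hyperplane 0 c0.
congr (_ = _); congr (lebesgue_rV k _).
by apply/seteqP; split=> v /=; rewrite raddf0.
Qed.

Lemma measurable_sphere_proj k : measurable_fun setT (@sphere_proj R k).
Proof.
apply/measurable_rVP => j; under eq_fun do rewrite mxE.
apply: measurable_funM; last exact: measurable_coor.
(* At [v = 0] both sides are [0], by convention. *)
rewrite (_ : (fun _ => _) =
    fun v : 'rV[R]_k => (\sum_j v ord0 j ^+ 2) `^ (- 2^-1)).
  apply: (measurableT_comp (measurable_powR _)).
  apply: (@measurable_sum _ _ _ _ _ _
    (fun i (v : 'rV[R]_k) => v ord0 i ^+ 2)) => i.
  by apply: measurable_funX; exact: measurable_coor.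
by apply/funext => v; rewrite powRN powR12_sqrt// sumr_ge0// => i _; rewrite sqr_ge0.
Qed.

Lemma sphere_projN k (v : 'rV[R]_k) : sphere_proj (- v) = - sphere_proj v.
Proof.
rewrite /sphere_proj scalerN; congr (- (_^-1 *: _)); congr Num.sqrt.
by apply: eq_bigr => i _; rewrite mxE sqrrN.
Qed.

Lemma symmetric_measure_proj k d (T : measurableType d) (P : probability T R)
    (X : {RV P >-> 'rV[R]_k}) :
  symmetric_measure (distribution P X) -> symmetric_proj X.
Proof.
move=> sX A mA.
have mS : measurable [set v : 'rV[R]_k | A (sphere_proj v)].
  by rewrite -[X in measurable X]setTI; exact: measurable_sphere_proj.
have := sX _ mS; rewrite /distribution /pushforward /= => <-.
by congr (P _); apply/seteqP; split=> w /=; rewrite sphere_projN.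
Qed.

(** The side is one, so that the density of the uniform law is an indicator. *)
Definition cube k : set 'rV[R]_k :=
  [set v | forall j, v ord0 j \in `[- 2^-1, 2^-1]].

Arguments cube : clear implicits.

Lemma measurable_cube k : measurable (cube k).
Proof.
rewrite (_ : cube k = \bigcap_(j in [set: 'I_k])
    ((fun v : 'rV[R]_k => v ord0 j : measurableTypeR R) @^-1`
      `[- 2^-1, 2^-1]%classic)).
  apply: fin_bigcap_measurable => // j _.
  by rewrite -[X in measurable X]setTI; apply: measurable_coor.
by apply/seteqP; split=> [v vc j _|v vc j]; [exact: vc|exact: (vc j)].
Qed.

Definition uniform_cube k : set 'rV[R]_k -> \bar R :=
  mrestr (lebesgue_rV k) (@measurable_cube k).

Arguments uniform_cube : clear implicits.

HB.instance Definition _ k := Measure.on (uniform_cube k).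

Let uniform_cubeT k : uniform_cube k setT = 1%E.
Proof.
rewrite /uniform_cube /mrestr setTI.
have := @lebesgue_rV_box R k (fun=> `[- 2^-1, 2^-1]%classic)
  (fun=> measurable_itv _).
rewrite /cube => ->; apply: big1 => j _.
rewrite lebesgue_measure_itv/= lte_fin ifT; last by rewrite gtrN.
by rewrite -EFinD opprK -[2^-1]mul1r -splitr.
Qed.

HB.instance Definition _ k :=
  Measure_isProbability.Build _ _ _ (uniform_cube k) (@uniform_cubeT k).

Lemma symmetric_uniform_cube k : symmetric_measure (uniform_cube k).
Proof.
move=> A mA; rewrite /uniform_cube /mrestr.
rewrite -[RHS](@symmetric_lebesgue_rV k); last first.
  exact: measurableI (@measurable_cube k).
congr (lebesgue_rV k _); apply/seteqP; split=> v /= [Av vc]; split=> // j.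
  by rewrite mxE oppr_itvcc opprK; exact: vc.
by have := vc j; rewrite mxE oppr_itvcc opprK.
Qed.

End Lebesgue.

Arguments cube : clear implicits.
Arguments uniform_cube : clear implicits.

(** * The supremum is given by Wendel's recursion *)

Section HullBound.
Context {R : realType}.

Lemma hull_prob_iid k n d (T : measurableType d) (P : probability T R)
    (X : {RV P >-> 'rV[R]_k}) d' (T' : measurableType d')
    (P' : probability T' R) (Y : 'I_n -> {RV P' >-> 'rV[R]_k}) :
  iid_copies X Y ->
  hull_prob Y = iter_prod (distribution P X) n (hull_tuples R k n).
Proof.
move=> [dY iY].
rewrite -(@iid_law _ _ R (distribution P X) n _ _ P' (fun i w => Y i w)).
- congr (P' _); apply/funext => w /=; rewrite /hull_tuples /=.
  rewrite (_ : tnth _ = fun i => Y i w)//.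
  by apply/funext => i; rewrite tnth_mktuple.
- by move=> i; exact: measurable_funPT.
- move=> A mA.
  transitivity (P' (\bigcap_(i in [set: 'I_n]) (Y i @^-1` A i))).
    by congr (P' _); apply/seteqP; split=> w /= Aw i; [|exact: (Aw i I)];
      move=> _; exact: (Aw i).
  by rewrite iY//; apply: eq_bigr => i _; exact: (dY i _ (mA i)).
- exact: measurable_hull_tuples.
Qed.

Lemma b_le0 k n : (n <= k)%N -> (b R k n <= 0)%E.
Proof.
move=> nk; apply: ub_ereal_sup => _ [d [T [P [X [d' [T' [P' [Y [cX iY ->]]]]]]]]].
rewrite (hull_prob_iid iY) hull_null//; exact: continuous_null_hyperplanes.
Qed.

Let cube_point k : {RV uniform_cube R k >-> 'rV[R]_k} :=
  mfun_Sub (mem_set (@measurable_id _ 'rV[R]_k setT) : _ \in mfun).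

Let cube_sample k n i : {RV iter_prod (uniform_cube R k) n >-> 'rV[R]_k} :=
  mfun_Sub (mem_set (@measurable_tnth _ 'rV[R]_k n i) : _ \in mfun).

Let continuous_cube_point k : continuous_rvec (cube_point k).
Proof.
exists (\1_(cube R k)); split=> [|x|A mA].
- by apply: measurable_indic; exact: measurable_cube.
- by rewrite indicE.
- by rewrite integral_indic//; [rewrite setIC|exact: measurable_cube].
Qed.

Let iid_cube_sample k n : iid_copies (cube_point k) (cube_sample k (n:=n)).
Proof.
have dY i A : measurable A ->
    distribution (iter_prod (uniform_cube R k) n) (cube_sample k i) A =
    distribution (uniform_cube R k) (cube_point k) A.
  move=> mA; rewrite /distribution /pushforward /=.
  transitivity (iter_prod (uniform_cube R k) n
    (box (fun j => if j == i then A else setT))).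
    congr (iter_prod _ _ _); apply/seteqP; split=> x /=.
      by move=> Ax j; case: eqP => [->|].
    by move=> /(_ i); rewrite eqxx.
  rewrite iter_prod_box; last by move=> j; case: ifP.
  rewrite (bigD1 i)//= eqxx big1 ?mule1 => [|j /negPf ->]; first exact: erefl.
  exact: (probability_setT (uniform_cube R k)).
split=> // A mA.
transitivity (iter_prod (uniform_cube R k) n (box A)).
  congr (iter_prod _ _ _); apply/seteqP; split=> x /=.
    by move=> Ax i; exact: (Ax i I).
  by move=> Ax i _; exact: Ax.
by rewrite iter_prod_box//; apply: eq_bigr => i _; exact/esym/(dY i _ (mA i)).
Qed.

Lemma b_wendel k n :
  (forall (d : measure_display) (T : measurableType d) (P : probability T R)
      (X : {RV P >-> 'rV[R]_k})
      (d' : measure_display) (T' : measurableType d') (P' : probability T' R)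
      (Y : 'I_n -> {RV P' >-> 'rV[R]_k}),
    continuous_rvec X -> iid_copies X Y ->
    hull_prob Y = b R k n <-> symmetric_proj X) ->
  b R k n = (wendel n k)%:E.
Proof.
move=> H.
have sX : symmetric_measure (distribution (uniform_cube R k) (cube_point k)).
  exact: symmetric_uniform_cube.
rewrite -((H _ _ _ _ _ _ _ _ (@continuous_cube_point k)
  (@iid_cube_sample k n)).2 (symmetric_measure_proj sX)).
rewrite (hull_prob_iid (@iid_cube_sample k n)) hull_wendel//.
exact: continuous_null_hyperplanes.
Qed.

End HullBound.

(** * Monotonicity and asymptotics of the recursion *)

Section WendelBounds.
Context {R : realType}.

Lemma wendel_ge0_le1 n k : 0 <= (wendel n k : R) <= 1.
Proof.
elim: n k => [|n IHn] [|k] /=; rewrite ?lexx ?ler01//.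
by have := IHn k; have := IHn k.+1; lra.
Qed.

Lemma wendel_eq0 n k : (n <= k)%N -> (wendel n k : R) = 0.
Proof.
elim: n k => [//|n IHn] [//|k] nk /=.
by rewrite !IHn ?(leq_trans _ nk)// addr0 mul0r.
Qed.

Lemma wendel_decr n k : (k < n)%N -> wendel n k.+1 < (wendel n k : R).
Proof.
elim: n k => [//|n IHn] [|k] kn /=.
  case: n => [|n] in IHn kn *; first by rewrite /=; lra.
  by have := IHn 0%N isT; rewrite /=; lra.
have := IHn k kn; have [kn1|kn1] := ltnP k.+1 n; first by have := IHn _ kn1; lra.
by rewrite (@wendel_eq0 n k.+2 (leq_trans kn1 _))// (wendel_eq0 kn1); lra.
Qed.

Lemma wendel_incr n k : (0 < k <= n)%N -> wendel n k < (wendel n.+1 k : R).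
Proof.
case: k => [//|k] /= kn.
by have := wendel_decr kn; lra.
Qed.

(** The right-hand side satisfies the recursion of [wendel]: with
    [e = 2 * k.+1 - n.+1 + D], it replaces [e] by [e + 1] or [e - 1], and
    [((e + 1) ^ 2 + (e - 1) ^ 2) / 2 = e ^ 2 + 1]. The sign of [D] makes the
    boundary case [k = 0], where [wendel] is [1], hold. *)
Lemma wendel_tail_le (D : R) n k : D <= 0 ->
  wendel n k * D ^+ 2 <= (2 * k%:R - n%:R + D) ^+ 2 + n%:R.
Proof.
move=> D0; elim: n k => [|n IHn] [|k] //=.
- by rewrite mul0r addr_ge0// sqr_ge0.
- by rewrite mul0r addr_ge0// sqr_ge0.
- have n0 : 0 <= n.+1%:R :> R by [].
  rewrite mul1r; nra.
- have := IHn k; have := IHn k.+1; rewrite -(natr1 n) -(natr1 k); nra.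
Qed.

(** The same comparison for [1 - wendel], whose boundary value is [1] at
    [n = 0]. *)
Lemma wendel_head_le (D : R) n k : 0 <= D ->
  (1 - wendel n k) * D ^+ 2 <= (2 * k%:R - n%:R + D) ^+ 2 + n%:R.
Proof.
move=> D0; elim: n k => [|n IHn] [|k] //=.
- by rewrite subr0 mul1r; nra.
- have k0 : 0 <= k.+1%:R :> R by [].
  by rewrite subr0 mul1r; nra.
- by rewrite subrr mul0r addr_ge0// sqr_ge0.
- have := IHn k; have := IHn k.+1; rewrite -(natr1 n) -(natr1 k); nra.
Qed.

Lemma quadratic_rate (p c D N : R) : 0 <= p -> 0 < c -> 0 < N ->
  c * N <= `|D| -> p * D ^+ 2 <= N -> p <= (c ^+ 2)^-1 / N.
Proof.
move=> p0 c0 N0 cD pD.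
have cN0 : 0 <= c * N by rewrite mulr_ge0 ?ltW.
have {}pD : p * (c * N) ^+ 2 <= N.
  apply: le_trans pD; rewrite ler_wpM2l// -[leRHS]real_normK ?num_real//.
  by rewrite ler_sqr ?nnegrE.
rewrite -invfM -[leRHS]mul1r ler_pdivlMr ?mulr_gt0 ?exprn_gt0//.
rewrite -(ler_pM2r N0) mul1r; apply: le_trans pD.
by rewrite exprMn [N ^+ 2]expr2 !mulrA.
Qed.

(** [D = n - 2k] cancels the square in [wendel_tail_le]. *)
Lemma wendel_small (c : R) n k : 0 < c -> (0 < n)%N ->
  c * n%:R <= 2 * k%:R - n%:R -> wendel n k <= (c ^+ 2)^-1 / n%:R.
Proof.
move=> c0 n0 cn.
have n0' : 0 < n%:R :> R by rewrite ltr0n.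
have D0 : n%:R - 2 * k%:R <= 0 :> R by nra.
have /andP[w0 _] := wendel_ge0_le1 n k.
apply: (@quadratic_rate _ _ (n%:R - 2 * k%:R)) => //.
  by rewrite ler0_norm// opprB.
by have := wendel_tail_le n k D0; rewrite addrA subrK subrr expr0n add0r.
Qed.

Lemma wendel_large (c : R) n k : 0 < c -> (0 < n)%N ->
  c * n%:R <= n%:R - 2 * k%:R -> 1 - wendel n k <= (c ^+ 2)^-1 / n%:R.
Proof.
move=> c0 n0 cn.
have n0' : 0 < n%:R :> R by rewrite ltr0n.
have D0 : 0 <= n%:R - 2 * k%:R :> R by nra.
have /andP[_ w1] := wendel_ge0_le1 n k.
apply: (@quadratic_rate _ _ (n%:R - 2 * k%:R)) => //.
- by rewrite subr_ge0.
- by rewrite ger0_norm.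
by have := wendel_head_le n k D0; rewrite addrA subrK subrr expr0n add0r.
Qed.

Lemma nat_int_below (x : R) : 1 < x ->
  [/\ (0 < `|int_below x|)%N, (`|int_below x|)%:R < x &
    x <= (`|int_below x|)%:R + 1].
Proof.
move=> x1.
have i1 : 1 <= int_below x by rewrite int_belowP.
have i0 : 0 <= int_below x by apply: le_trans i1.
have e : (`|int_below x|)%:R = (int_below x)%:~R :> R by rewrite natr_absz ger0_norm.
split; first by rewrite absz_gt0 gt_eqF// (lt_le_trans _ i1).
  by rewrite e -int_belowP.
rewrite e leNgt; apply/negP => h.
suff : int_below x + 1 <= int_below x by rewrite gerDl.
by rewrite int_belowP intrD.
Qed.

Lemma cvg_divn (c : R) : c / n%:R @[n --> \oo] --> 0.
Proof.
rewrite -cvg_shiftS /=.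
have : (cst c \* harmonic) n @[n --> \oo] --> c * 0.
  exact: cvgM (cvg_cst c) cvg_harmonic.
by rewrite mulr0.
Qed.

End WendelBounds.

Lemma cvg_EFin_rate (R : realType) (u : nat -> \bar R) (w : nat -> R) (l c : R) :
  (\forall n \near \oo, u n = (w n)%:E /\ l - c / n%:R <= w n <= l + c / n%:R) ->
  u n @[n --> \oo] --> l%:E.
Proof.
move=> uw.
apply: (@squeeze_cvge _ _ _ _ (fun n => (l - c / n%:R)%:E) _
  (fun n => (l + c / n%:R)%:E)).
- by apply: filterS uw => n [-> wl]; rewrite !lee_fin.
- apply: cvg_EFin; first exact: nearW.
  rewrite -[X in _ --> X]subr0; apply: cvgB; [exact: cvg_cst|exact: cvg_divn].
- apply: cvg_EFin; first exact: nearW.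
  rewrite -[X in _ --> X]addr0; apply: cvgD; [exact: cvg_cst|exact: cvg_divn].
Qed.

Section Limits.
Context {R : realType}.

Lemma b_cvg1 (eps : R) :
  (forall k n, (1 <= k)%N -> (k < n)%N -> b R k n = (wendel n k)%:E) ->
  0 < eps -> eps < 2^-1 ->
  b R `|int_below (eps * n%:R)|%N n @[n --> \oo] --> 1%:E.
Proof.
move=> bE e0 e2.
apply: (@cvg_EFin_rate _ _ (fun n => wendel n `|int_below (eps * n%:R)|%N) 1
  (((1 - 2 * eps) ^+ 2)^-1)).
near=> n.
have n0 : (0 < n)%N by near: n; exact: nbhs_infty_ge.
have nr0 : 0 < n%:R :> R by rewrite ltr0n.
have n1 : 1 < eps * n%:R.
  rewrite mulrC -ltr_pdivrMr// div1r.
  have : eps^-1 + 1 <= n%:R by near: n; exact: nbhs_infty_ger.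
  lra.
have [k0 kx _] := nat_int_below n1.
split.
  rewrite bE// -(ltr_nat R); apply: lt_le_trans kx _; nra.
have /andP[_ w1] := wendel_ge0_le1 (R:=R) n `|int_below (eps * n%:R)|%N.
have := @wendel_large R (1 - 2 * eps) n `|int_below (eps * n%:R)|%N.
have c0 : 0 < 1 - 2 * eps by lra.
have cn : 0 <= ((1 - 2 * eps) ^+ 2)^-1 / n%:R.
  by rewrite divr_ge0// invr_ge0 sqr_ge0.
move=> /(_ c0 n0) h; have {}h := h ltac:(lra).
by apply/andP; split; lra.
Unshelve. all: by end_near. Qed.

Lemma b_cvg0 (eps : R) :
  (forall k n, (1 <= k)%N -> (k < n)%N -> b R k n = (wendel n k)%:E) ->
  0 < eps -> eps < 2^-1 ->
  b R `|int_below ((1 - eps) * n%:R)|%N n @[n --> \oo] --> 0%:E.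
Proof.
move=> bE e0 e2.
apply: (@cvg_EFin_rate _ _ (fun n => wendel n `|int_below ((1 - eps) * n%:R)|%N) 0
  ((((1 - 2 * eps) / 2) ^+ 2)^-1)).
have c0 : 0 < (1 - 2 * eps) / 2 by lra.
near=> n.
have n0 : (0 < n)%N by near: n; exact: nbhs_infty_ge.
have nr0 : 0 < n%:R :> R by rewrite ltr0n.
have n1 : 1 < (1 - eps) * n%:R.
  have : 3 <= n%:R :> R by near: n; exact: nbhs_infty_ger.
  nra.
(* This absorbs the possible loss of one in rounding [(1 - eps) * n]. *)
have n4 : 2 <= (1 - 2 * eps) / 2 * n%:R.
  rewrite mulrC -ler_pdivrMr//; near: n; exact: nbhs_infty_ger.
have [k0 kx xk] := nat_int_below n1.
split.
  rewrite bE// -(ltr_nat R); apply: lt_le_trans kx _; nra.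
have /andP[w0 _] := wendel_ge0_le1 (R:=R) n `|int_below ((1 - eps) * n%:R)|%N.
have cn : 0 <= (((1 - 2 * eps) / 2) ^+ 2)^-1 / n%:R.
  by rewrite divr_ge0// invr_ge0 sqr_ge0.
have := @wendel_small R ((1 - 2 * eps) / 2) n
  `|int_below ((1 - eps) * n%:R)|%N c0 n0.
move=> h; have {}h := h ltac:(lra).
by apply/andP; split; lra.
Unshelve. all: by end_near. Qed.

End Limits.

Theorem theorem2 (R : realType)
  (attained_iff_symmetric : forall k n : nat, (1 <= k)%N -> (k < n)%N ->
    forall (d : measure_display) (T : measurableType d) (P : probability T R)
      (X : {RV P >-> 'rV[R]_k})
      (d' : measure_display) (T' : measurableType d') (P' : probability T' R)
      (Y : 'I_n -> {RV P' >-> 'rV[R]_k}),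
    continuous_rvec X -> iid_copies X Y ->
    hull_prob Y = b R k n <-> symmetric_proj X)
  (b_uniform : forall k n : nat, (1 <= k)%N -> (k < n)%N ->
    forall (d : measure_display) (T : measurableType d) (P : probability T R)
      (U : {RV P >-> 'rV[R]_k})
      (d' : measure_display) (T' : measurableType d') (P' : probability T' R)
      (V : 'I_n -> {RV P' >-> 'rV[R]_k}),
    uniform_on_sphere U -> iid_copies U V ->
    b R k n = hull_prob V) :
  (forall k n : nat, (1 <= k)%N -> (k < n)%N ->
    (b R k n < b R k n.+1)%E /\ (b R k.+1 n < b R k n)%E) /\
  (forall eps : R, 0 < eps -> eps < 2^-1 ->
    (b R `|int_below (eps * n%:R)|%N n @[n --> \oo] --> 1%:E) /\
    (b R `|int_below ((1 - eps) * n%:R)|%N n @[n --> \oo] --> 0%:E)).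
Proof.
have bE k n : (1 <= k)%N -> (k < n)%N -> b R k n = (wendel n k)%:E.
  by move=> k0 kn; apply: b_wendel; exact: attained_iff_symmetric.
split=> [k n k0 kn|eps e0 e2]; last first.
  by split; [exact: (b_cvg1 bE)|exact: (b_cvg0 bE)].
rewrite (bE k n)// (bE k n.+1)//; last exact: leqW.
split; first by rewrite lte_fin wendel_incr// k0 ltnW.
have [k1n|nk] := ltnP k.+1 n; first by rewrite bE// lte_fin wendel_decr.
(* Here [n = k.+1], and [wendel n k.+1 = 0]. *)
apply: le_lt_trans (b_le0 nk) _; rewrite lte_fin.
by rewrite -(wendel_eq0 (R:=R) nk) wendel_decr.
Qed.
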